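(* Suppose that $f:G\to G'$ is a homomorphism between finite groups. Then the following are equivalent: (1) $f$ is injective; (2) $f^{-1}_L=f^{-1}_R$ as maps $\mathbf{Tr}(G')\to\mathbf{Tr}(G)$; (3) $f^{-1}_L:\mathbf{Tr}(G')\to\mathbf{Tr}(G)$ has a left adjoint. Moreover, if $f$ is noninjective, then there is a strict inequality $f^{-1}_L(\rightsquigarrow)\subsetneq f^{-1}_R(\rightsquigarrow)$ for every $G'$-transfer system $\rightsquigarrow$.
   Context: For a finite group $G$, $\mathbf{Sub}(G)$ is the set of subgroups of $G$. A $G$-transfer system is a partial order $\to$ on $\mathbf{Sub}(G)$ such that $K\to H$ implies: $K\subset H$; $gKg^{-1}\to gHg^{-1}$ for every $g\in G$; and $L\cap K\to L$ for every subgroup $L\subset H$. Relations are identified with sets of pairs, and $\mathbf{Tr}(G)$ is the poset of $G$-transfer systems ordered by inclusion (refinement). Every relation on $\mathbf{Sub}(G)$ refining inclusion is contained in a least transfer system, and every partial order on $\mathbf{Sub}(G)$ refining inclusion contains a largest transfer system. For a homomorphism $f:G\to G'$ and $\rightsquigarrow\ \in\mathbf{Tr}(G')$: $f^{-1}_L(\rightsquigarrow)$ is the least $G$-transfer system containing $\{(f^{-1}K',f^{-1}H')\mid K'\rightsquigarrow H'\}$, and $f^{-1}_R(\rightsquigarrow)$ is the largest $G$-transfer system contained in $\{(K,H)\mid K\subset H\subset G,\ f(K)\rightsquigarrow f(H)\}$. Adjoints are in the sense of order-preserving maps of posets (Galois connections). *)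

(* Defs.v *)
From HB Require Import structures.
From mathcomp Require Import all_boot all_order all_fingroup.

Set Implicit Arguments.
Unset Strict Implicit.
Unset Printing Implicit Defensive.

Import Order.Theory.
Local Open Scope group_scope.

Section TransferSystems.

Variables (gT : finGroupType) (G : {group gT}).
Implicit Types R : {set {group gT} * {group gT}}.

(* R is a partial order with carrier Sub(G): it only relates subgroups of G,
   and it is reflexive on those. *)
Definition sub_porder R : bool :=
  [&& R \subset setX (subgroups G) (subgroups G),
      [forall K in subgroups G, (K, K) \in R],
      [forall K, forall H, ((K, H) \in R) && ((H, K) \in R) ==> (K == H)] &
      [forall K, forall H, forall M,
         ((K, H) \in R) && ((H, M) \in R) ==> ((K, M) \in R)]].

Definition refines_incl R : bool :=
  [forall K : {group gT}, forall H : {group gT}, ((K, H) \in R) ==> (K \subset H)].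

(* [H :^ g] is g^-1 H g, hence the inverse below. *)
Definition conj_closed R : bool :=
  [forall K : {group gT}, forall H : {group gT}, forall g in G,
     ((K, H) \in R) ==> ((K :^ g^-1, H :^ g^-1)%G \in R)].

Definition restr_closed R : bool :=
  [forall K : {group gT}, forall H : {group gT}, forall L : {group gT},
     ((K, H) \in R) && (L \subset H) ==> ((L :&: K, L)%G \in R)].

Definition transfer_system R : bool :=
  [&& sub_porder R, refines_incl R, conj_closed R & restr_closed R].

Record Tr := MkTr { tr_rel :> {set {group gT} * {group gT}};
                    tr_relP : transfer_system tr_rel }.

HB.instance Definition _ := [isSub for tr_rel].
HB.instance Definition _ := [Finite of Tr by <:].

Definition tr_le (S T : Tr) : bool := tr_rel S \subset tr_rel T.

Fact tr_le_refl : reflexive tr_le. Proof. by move=> S; apply: subxx. Qed.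
Fact tr_le_anti : antisymmetric tr_le.
Proof. by move=> S T; rewrite /tr_le -eqEsubset => /eqP /val_inj. Qed.
Fact tr_le_trans : transitive tr_le.
Proof. by move=> T S U; apply: subset_trans. Qed.

End TransferSystems.

Fact tr_display : Order.disp_t. Proof. exact: Order.Disp tt tt. Qed.

HB.instance Definition _ (gT : finGroupType) (G : {group gT}) :=
  Order.Le_isPOrder.Build tr_display (Tr G)
    (@tr_le_refl gT G) (@tr_le_anti gT G) (@tr_le_trans gT G).

Section Generation.

Variables (gT : finGroupType) (G : {group gT}).
Implicit Types (R : {set {group gT} * {group gT}}) (T U : Tr G).

Lemma transfer_systemP R :
  reflect
    [/\ forall K H, (K, H) \in R -> [/\ K \subset H & H \subset G],
        forall K : {group gT}, K \subset G -> (K, K) \in R,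
        forall K H M, (K, H) \in R -> (H, M) \in R -> (K, M) \in R,
        forall K H g, g \in G -> (K, H) \in R -> (K :^ g, H :^ g)%G \in R &
        forall K H (L : {group gT}), (K, H) \in R -> L \subset H ->
          (L :&: K, L)%G \in R]
    (transfer_system G R).
Proof.
apply: (iffP and4P).
  case=> /and4P[/subsetP sR /forall_inP rR _ tR] iR cR eR; split.
  - move=> K H KH; split; first by have /forallP/(_ K)/forallP/(_ H) := iR; rewrite KH.
    by have := sR _ KH; rewrite inE /= !inE => /andP[].
  - by move=> K sKG; apply: rR; rewrite inE.
  - move=> K H M KH HM.
    by have /forallP/(_ K)/forallP/(_ H)/forallP/(_ M) := tR; rewrite KH HM.
  - move=> K H g gG KH.
    have /forallP/(_ K)/forallP/(_ H)/forall_inP/(_ g^-1) := cR.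
    by rewrite groupV KH invgK => /(_ gG).
  - move=> K H L KH LH.
    by have /forallP/(_ K)/forallP/(_ H)/forallP/(_ L) := eR; rewrite KH LH.
case=> iR rR tR cR eR; split.
- apply/and4P; split.
  + apply/subsetP=> -[K H] /iR[sKH sHG]; rewrite !inE /= sHG andbT.
    exact: subset_trans sHG.
  + by apply/forall_inP=> K; rewrite inE; apply: rR.
  + apply/forallP=> K; apply/forallP=> H; apply/implyP=> /andP[/iR[KH _] /iR[HK _]].
    by apply/eqP/val_inj/eqP; rewrite eqEsubset KH.
  + apply/forallP=> K; apply/forallP=> H; apply/forallP=> M.
    by apply/implyP=> /andP[]; apply: tR.
- by apply/forallP=> K; apply/forallP=> H; apply/implyP=> /iR[].
- apply/forallP=> K; apply/forallP=> H; apply/forall_inP=> g gG.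
  by apply/implyP=> KH; apply: cR; rewrite ?groupV.
- apply/forallP=> K; apply/forallP=> H; apply/forallP=> L.
  by apply/implyP=> /andP[]; apply: eR.
Qed.

Definition incl_rel : {set {group gT} * {group gT}} :=
  [set p : {group gT} * {group gT} | (p.1 \subset p.2) && (p.2 \subset G)].

Lemma incl_relP : transfer_system G incl_rel.
Proof.
apply/transfer_systemP; split.
- by move=> K H; rewrite inE /= => /andP[].
- by move=> K sKG; rewrite inE /= subxx.
- move=> K H M; rewrite !inE /= => /andP[KH _] /andP[HM ->].
  by rewrite (subset_trans KH).
- move=> K H g gG; rewrite !inE /= conjSg => /andP[-> HG].
  by rewrite conj_subG.
- move=> K H L; rewrite !inE /= => /andP[_ HG] LH.
  by rewrite subsetIl (subset_trans LH).
Qed.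

Definition tr_incl : Tr G := MkTr incl_relP.

Definition is_least_tr R T : Prop :=
  R \subset tr_rel T /\ forall U : Tr G, R \subset tr_rel U -> (T <= U)%O.

Definition is_largest_tr R T : Prop :=
  tr_rel T \subset R /\ forall U : Tr G, tr_rel U \subset R -> (U <= T)%O.

(* The default value [tr_incl] is returned only when the extremum does not
   exist; see [least_trP] and [largest_trP]. *)
Definition least_tr R : Tr G :=
  odflt tr_incl
    [pick T : Tr G | (R \subset tr_rel T) &&
                     [forall U : Tr G, (R \subset tr_rel U) ==> (T <= U)%O]].

Definition largest_tr R : Tr G :=
  odflt tr_incl
    [pick T : Tr G | (tr_rel T \subset R) &&
                     [forall U : Tr G, (tr_rel U \subset R) ==> (U <= T)%O]].

Lemma least_trP R : R \subset incl_rel -> is_least_tr R (least_tr R).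
Proof.
move=> sR; rewrite /least_tr; case: pickP => [T /andP[RT /forallP lT]|noT].
  by split=> // U RU; apply: (implyP (lT U)).
pose B := \bigcap_(U : Tr G | R \subset tr_rel U) tr_rel U.
have inB p : reflect (forall U : Tr G, R \subset tr_rel U -> p \in tr_rel U) (p \in B).
  exact: bigcapP.
have tU (U : Tr G) := transfer_systemP _ (tr_relP U).
have BP : transfer_system G B.
  apply/transfer_systemP; split.
  - by move=> K H /inB/(_ tr_incl sR); rewrite inE /= => /andP[].
  - by move=> K KG; apply/inB=> U _; have [_ r _ _ _] := tU U; apply: r.
  - move=> K H M /inB KH /inB HM; apply/inB=> U RU; have [_ _ t _ _] := tU U.
    by apply: t (KH _ RU) (HM _ RU).
  - move=> K H g gG /inB KH; apply/inB=> U RU; have [_ _ _ c _] := tU U.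
    by apply: c (KH _ RU).
  - move=> K H L /inB KH LH; apply/inB=> U RU; have [_ _ _ _ e] := tU U.
    by apply: e (KH _ RU) LH.
have := noT (MkTr BP); case/negP; apply/andP; split.
  by apply/subsetP=> p pR; apply/inB=> U /subsetP; apply.
by apply/forallP=> U; apply/implyP=> RU; apply/subsetP=> p /inB; apply.
Qed.

Lemma eq_grp_pair R (A B C D : {group gT}) :
  A :=: C -> B :=: D -> (A, B) \in R -> (C, D) \in R.
Proof. by move=> /val_inj-> /val_inj->. Qed.

Lemma largest_trP R :
  sub_porder G R -> refines_incl R -> is_largest_tr R (largest_tr R).
Proof.
move=> /and4P[/subsetP sR /forall_inP rR _ tR] iR.
rewrite /largest_tr; case: pickP => [T /andP[RT /forallP lT]|noT].
  by split=> // U RU; apply: (implyP (lT U)).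
pose B := [set p in incl_rel | [forall g in G, forall L : {group gT},
            (L \subset p.2) ==> (((L :&: p.1) :^ g, L :^ g)%G \in R)]].
have inB (K H : {group gT}) :
  reflect [/\ K \subset H, H \subset G & forall g (L : {group gT}), g \in G ->
             L \subset H -> ((L :&: K) :^ g, L :^ g)%G \in R] ((K, H) \in B).
  rewrite !inE /=; apply: (iffP andP).
    case=> /andP[-> ->] /forall_inP c; split=> // g L /c/forallP/(_ L)/implyP.
    exact.
  case=> -> -> c; split=> //; apply/forall_inP=> g gG; apply/forallP=> L.
  by apply/implyP; apply: c.
have BP : transfer_system G B.
  apply/transfer_systemP; split.
  - by move=> K H /inB[].
  - move=> K KG; apply/inB; split=> // g L gG LK.
    have ->: (L :&: K)%G = L by apply/val_inj/setIidPl.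
    by apply: rR; rewrite inE conj_subG // (subset_trans LK).
  - move=> K H M /inB[KH _ c1] /inB[HM MG c2]; apply/inB; split=> //.
      exact: subset_trans HM.
    move=> g L gG LM; have a := c2 g L gG LM.
    have b := c1 g (L :&: H)%G gG (subsetIr _ _).
    have E : (L :&: H :&: K)%G = (L :&: K)%G.
      by apply/val_inj; rewrite /= -setIA (setIidPr KH).
    rewrite E in b.
    have /forallP/(_ ((L :&: K) :^ g)%G)/forallP/(_ ((L :&: H) :^ g)%G) := tR.
    by move=> /forallP/(_ (L :^ g)%G)/implyP; rewrite b a; apply.
  - move=> K H x xG /inB[KH HG c]; apply/inB; split; rewrite ?conjSg ?conj_subG //.
    move=> g L gG LH.
    have LH' : L :^ x^-1 \subset H by rewrite sub_conjgV.
    apply: eq_grp_pair (c (x * g) (L :^ x^-1)%G (groupM xG gG) LH').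
      by rewrite /= !conjIg -!conjsgM mulKg.
    by rewrite /= -conjsgM mulKg.
  - move=> K H M /inB[KH HG c] MH; apply/inB; split.
    + exact: subsetIl.
    + exact: subset_trans HG.
    move=> g L gG LM; apply: eq_grp_pair (c g L gG (subset_trans LM MH)) => //.
    by rewrite /= setIA (setIidPl LM).
have := noT (MkTr BP); case/negP; apply/andP; split.
  apply/subsetP=> -[K H] /inB[KH HG c].
  by apply: eq_grp_pair (c 1 H (group1 G) (subxx _));
    rewrite /= conjsg1 // (setIidPr KH).
apply/forallP=> U; apply/implyP=> /subsetP UR; apply/subsetP=> -[K H] KH.
have [i _ _ c e] := transfer_systemP _ (tr_relP U).
have [sKH sHG] := i _ _ KH; apply/inB; split=> // g L gG LH.
by apply: UR; apply: c => //; apply: e KH LH.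
Qed.

End Generation.

Section Inflation.

Variables (gT rT : finGroupType) (G : {group gT}) (G' : {group rT}).
Variable f : {morphism G >-> rT}.

Definition preim_rel (T : Tr G') : {set {group gT} * {group gT}} :=
  [set (f @*^-1 p.1, f @*^-1 p.2)%G | p in tr_rel T].

Definition image_rel (T : Tr G') : {set {group gT} * {group gT}} :=
  [set p : {group gT} * {group gT} |
     [&& p.1 \subset p.2, p.2 \subset G & (f @* p.1, f @* p.2)%G \in tr_rel T]].

Definition finvL (T : Tr G') : Tr G := least_tr G (preim_rel T).
Definition finvR (T : Tr G') : Tr G := largest_tr G (image_rel T).

Lemma finvLP T : is_least_tr (preim_rel T) (finvL T).
Proof.
apply: least_trP; apply/subsetP=> _ /imsetP[[K H] KH ->]; rewrite inE /=.
have [/(_ _ _ KH)[sKH _] _ _ _ _] := transfer_systemP _ _ (tr_relP T).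
by rewrite morphpreS // subsetIl.
Qed.

Lemma finvRP T : f @* G \subset G' -> is_largest_tr (image_rel T) (finvR T).
Proof.
move=> fG; have [i r t _ _] := transfer_systemP _ _ (tr_relP T).
have inR K H : ((K, H) \in image_rel T) =
   [&& K \subset H, H \subset G & (f @* K, f @* H)%G \in tr_rel T] by rewrite inE.
apply: largest_trP.
  apply/and4P; split.
  - apply/subsetP=> -[K H]; rewrite inR => /and3P[KH HG _].
    by rewrite !inE /= HG (subset_trans KH).
  - apply/forall_inP=> K; rewrite inE inR subxx => KG; rewrite KG /=; apply: r.
    exact: subset_trans (morphimS f KG) fG.
  - apply/forallP=> K; apply/forallP=> H; apply/implyP; rewrite !inR.
    case/andP=> /and3P[KH _ _] /and3P[HK _ _].
    by apply/eqP/val_inj/eqP; rewrite eqEsubset KH.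
  - apply/forallP=> K; apply/forallP=> H; apply/forallP=> M; apply/implyP.
    rewrite !inR => /andP[/and3P[KH _ a] /and3P[HM -> b]].
    by rewrite (subset_trans KH HM) /=; apply: t a b.
by apply/forallP=> K; apply/forallP=> H; apply/implyP; rewrite inR => /and3P[].
Qed.

End Inflation.

Arguments finvL {gT rT G} G' f T.
Arguments finvR {gT rT G} G' f T.

(* E is left adjoint to F: E y <= x iff y <= F x. *)
Definition has_left_adjoint d d' (P : porderType d) (Q : porderType d')
    (F : P -> Q) : Prop :=
  exists E : Q -> P,
    [/\ {homo F : x y / (x <= y)%O}, {homo E : x y / (x <= y)%O} &
        forall (y : Q) (x : P), (E y <= x)%O <-> (y <= F x)%O].

(* Main.v *)
(** The largest transfer system inside [image_rel T] consists of the pairs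
    [K <= H] with [f(L :&: K) -> f(L)] for every [L <= H]; it always contains
    the generators of [finvL T].  The pairs [K <= H] with the same intersection
    with [ker f] form a transfer system containing [finvL T], whereas [finvR T]
    contains [(1, ker f)], so the inclusion is strict as soon as [f] is not
    injective.  As [finvR] is right adjoint to the transfer system generated by
    the direct image, (2) implies (3).  Finally a right adjoint preserves the
    top element, which the strict inequality forbids for noninjective [f]. *)
Require Import Defs.
From mathcomp Require Import all_boot all_order all_fingroup.

Import Order.Theory.
Local Open Scope group_scope.

Lemma le_tr_incl (gT : finGroupType) (G : {group gT}) (S : Tr G) :
  (S <= tr_incl G)%O.
Proof.
apply/subsetP=> -[K H] KH; rewrite inE /=.
by have [/(_ _ _ KH)[-> ->] _ _ _ _] := transfer_systemP _ _ (tr_relP S).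
Qed.

Section Inverse.

Context {gT rT : finGroupType} {G : {group gT}} {G' : {group rT}}.
Context {f : {morphism G >-> rT}} (fG : f @* G \subset G').

Definition heredity_rel (T : Tr G') : {set {group gT} * {group gT}} :=
  [set p : {group gT} * {group gT} |
     [&& p.1 \subset p.2, p.2 \subset G &
         [forall L : {group gT}, (L \subset p.2) ==>
            ((f @* (L :&: p.1), f @* L)%G \in tr_rel T)]]].

Lemma heredity_relP (T : Tr G') (K H : {group gT}) :
  reflect [/\ K \subset H, H \subset G &
              forall L : {group gT}, L \subset H ->
                (f @* (L :&: K), f @* L)%G \in tr_rel T]
          ((K, H) \in heredity_rel T).
Proof.
rewrite inE /=; apply: (iffP and3P) => -[-> -> h]; split=> //.
  by move=> L; apply/implyP/(forallP h).
by apply/forallP=> L; apply/implyP/h.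
Qed.

(** Quantifying over [L] builds in restriction, and transitivity chains [f(L :&: K)], [f(L :&: H)],
    [f(L)] in [T]. *)
Lemma heredity_transfer (T : Tr G') : transfer_system G (heredity_rel T).
Proof.
have [i r t c e] := transfer_systemP _ _ (tr_relP T).
apply/transfer_systemP; split.
- by move=> K H /heredity_relP[].
- move=> K KG; apply/heredity_relP; split=> // L LK.
  apply: eq_grp_pair (r (f @* L)%G _) => //=; first by rewrite (setIidPl LK).
  by rewrite (subset_trans _ fG) ?morphimS ?(subset_trans LK).
- move=> K H M /heredity_relP[KH _ h1] /heredity_relP[HM MG h2].
  apply/heredity_relP; split=> //; first exact: subset_trans HM.
  move=> L LM; apply: t (h2 L LM).
  apply: eq_grp_pair (h1 (L :&: H)%G (subsetIr _ _)) => //=.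
  by rewrite -setIA (setIidPr KH).
- move=> K H g gG /heredity_relP[KH HG h].
  apply/heredity_relP; split; rewrite ?conjSg ?conj_subG // => L LH.
  (* Pull [L] back into [H] by [g^-1]; conjugating by [f g] inside [T] returns its image to
     [f(L)]. *)
  have LH' : L :^ g^-1 \subset H by rewrite sub_conjgV.
  have fgG : f g \in G' by apply: (subsetP fG); apply: mem_morphim.
  apply: eq_grp_pair (c _ _ _ fgG (h (L :^ g^-1)%G LH')).
    by rewrite /= -morphimJ // conjIg conjsgKV.
  by rewrite /= -morphimJ // conjsgKV.
- move=> K H M /heredity_relP[KH HG h] MH.
  apply/heredity_relP; split; rewrite ?subsetIl ?(subset_trans MH) // => L LM.
  apply: eq_grp_pair (h L (subset_trans LM MH)) => //=.
  by rewrite setIA (setIidPl LM).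
Qed.

(** The case [L = H] gives membership in [image_rel T]; maximality of [finvR] concludes. *)
Lemma heredity_le_finvR (T : Tr G') : heredity_rel T \subset tr_rel (finvR G' f T).
Proof.
have [_ /(_ (MkTr (heredity_transfer T)))] := finvRP T fG; apply.
apply/subsetP=> -[K H] /heredity_relP[KH HG h]; rewrite inE /= KH HG.
by apply: eq_grp_pair (h H (subxx _)) => //=; rewrite (setIidPr KH).
Qed.

Lemma finvL_le_finvR (T : Tr G') : (finvL G' f T <= finvR G' f T)%O.
Proof.
have [i _ _ _ e] := transfer_systemP _ _ (tr_relP T).
have [_ minL] := finvLP f T; apply: minL.
apply: subset_trans (heredity_le_finvR T).
apply/subsetP=> _ /imsetP[[K H] KH ->] /=; have [sKH _] := i _ _ KH.
apply/heredity_relP; split; rewrite /= ?morphpreS ?subsetIl // => L LH.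
have LG : L \subset G by apply: subset_trans LH (subsetIl _ _).
have fLH : f @* L \subset H by rewrite sub_morphim_pre.
(* Since the image of [L :&: f @*^-1 K] is [f(L) :&: K], this is the restriction of [(K, H)] to
   [f(L)]. *)
by apply: eq_grp_pair (e _ _ (f @* L)%G KH fLH) => //=; rewrite morphim_setIpre.
Qed.

Definition same_kernel_rel : {set {group gT} * {group gT}} :=
  [set p : {group gT} * {group gT} |
     [&& p.1 \subset p.2, p.2 \subset G & p.1 :&: 'ker f == p.2 :&: 'ker f]].

Lemma same_kernel_transfer : transfer_system G same_kernel_rel.
Proof.
apply/transfer_systemP; split.
- by move=> K H; rewrite inE /= => /and3P[].
- by move=> K KG; rewrite inE /= subxx KG eqxx.
- move=> K H M; rewrite !inE /= => /and3P[KH _ /eqP->] /and3P[HM -> ->].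
  by rewrite (subset_trans KH).
- move=> K H g gG; rewrite !inE /= => /and3P[KH HG /eqP eKH].
  rewrite conjSg KH conj_subG //=.
  (* The kernel is its own conjugate, so conjugation commutes with intersecting with it. *)
  have /normP kg : g \in 'N('ker f) by apply: (subsetP (ker_norm f)).
  by rewrite -{1 2}kg -!conjIg eKH.
- move=> K H L; rewrite !inE /= => /and3P[KH HG /eqP eKH] LH.
  rewrite subsetIl (subset_trans LH) //=.
  by rewrite -setIA eKH setIA (setIidPl LH).
Qed.

(** Preimages contain the kernel, so on generators both intersections are all of ['ker f]. *)
Lemma finvL_same_kernel (T : Tr G') : tr_rel (finvL G' f T) \subset same_kernel_rel.
Proof.
have [_ /(_ (MkTr same_kernel_transfer))] := finvLP f T; apply.
apply/subsetP=> _ /imsetP[[K H] KH ->]; rewrite inE /=.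
have [/(_ _ _ KH)[sKH _] _ _ _ _] := transfer_systemP _ _ (tr_relP T).
rewrite morphpreS // subsetIl /=.
by rewrite !(setIidPr _) // kerE morphpreS ?sub1G.
Qed.

(** Every subgroup of the kernel has trivial image, so only reflexivity of [T] at [1] is at
    stake. *)
Lemma finvR_one_ker (T : Tr G') : (1, 'ker f)%G \in tr_rel (finvR G' f T).
Proof.
have [_ r _ _ _] := transfer_systemP _ _ (tr_relP T).
apply: (subsetP (heredity_le_finvR T)); apply/heredity_relP.
split; rewrite ?sub1G ?subsetIl // => L LK.
apply: eq_grp_pair (r 1%G (sub1G _)) => /=.
  by rewrite (setIidPr (sub1G L)) morphim1.
by apply/esym/trivgP; rewrite -(morphim_ker f) morphimS.
Qed.

Lemma finvL_lt_finvR (T : Tr G') :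
  ~ {in G &, injective f} -> (finvL G' f T < finvR G' f T)%O.
Proof.
move=> ninj; rewrite lt_neqAle finvL_le_finvR andbT; apply/eqP=> eLR.
apply: ninj; apply/injmP.
have := finvR_one_ker T; rewrite -eLR => /(subsetP (finvL_same_kernel T)).
by rewrite inE /= setIid => /and3P[_ _ /eqP <-]; apply: subsetIl.
Qed.

(** For injective [f], a subgroup of [G] is the preimage of its image, so each pair in [image_rel T]
    is already a generator of [finvL]. *)
Lemma finvR_le_finvL (T : Tr G') :
  {in G &, injective f} -> (finvR G' f T <= finvL G' f T)%O.
Proof.
move=> /injmP injf.
have [sR _] := finvRP T fG; have [sL _] := finvLP f T.
apply: subset_trans sR (subset_trans _ sL).
apply/subsetP=> -[K H]; rewrite inE /= => /and3P[KH HG fKH].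
apply/imsetP; exists ((f @* K)%G, (f @* H)%G) => //=.
by congr (_, _); apply/val_inj; rewrite /= injmK ?(subset_trans KH).
Qed.

Lemma finvR_left_adjoint : has_left_adjoint (finvR G' f).
Proof.
pose dir (S : Tr G) : {set {group rT} * {group rT}} :=
  [set (f @* p.1, f @* p.2)%G | p in tr_rel S].
pose E S := least_tr G' (dir S).
have dirP S : is_least_tr (dir S) (E S).
  apply: least_trP; apply/subsetP=> _ /imsetP[[K H] KH ->]; rewrite inE /=.
  have [/(_ _ _ KH)[sKH sHG] _ _ _ _] := transfer_systemP _ _ (tr_relP S).
  by rewrite morphimS // (subset_trans _ fG) ?morphimS.
(* Both sides say that [T] relates [f(K)] to [f(H)] whenever [S] relates [K] to [H]. *)
have adj S T : (E S <= T)%O <-> (S <= finvR G' f T)%O.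
  have [dirE minE] := dirP S; have [sR maxR] := finvRP T fG.
  split=> [ET | SR].
    apply: maxR; apply/subsetP=> -[K H] KH; rewrite inE /=.
    have [/(_ _ _ KH)[-> ->] _ _ _ _] := transfer_systemP _ _ (tr_relP S).
    by apply: (subsetP ET); apply: (subsetP dirE); apply/imsetP; exists (K, H).
  apply: minE; apply/subsetP=> _ /imsetP[[K H] KH ->].
  by have := subsetP sR _ (subsetP SR _ KH); rewrite inE => /and3P[].
exists E; split=> // [T U TU | S U SU].
  (* Monotonicity of both maps is formal from the adjunction. *)
  by apply/adj; apply: le_trans TU; apply/adj.
by apply/adj; apply: le_trans SU _; apply/adj.
Qed.

End Inverse.

Theorem proposition5p13 (gT rT : finGroupType) (G : {group gT}) (G' : {group rT})
    (f : {morphism G >-> rT}) (fG : f @* G \subset G') :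
  [<-> {in G &, injective f};
       finvL G' f =1 finvR G' f;
       has_left_adjoint (finvL G' f)] /\
  (~ {in G &, injective f} -> forall T : Tr G', (finvL G' f T < finvR G' f T)%O).
Proof.
split; last by move=> ninj T; apply: finvL_lt_finvR.
tfae.
- move=> injf T; apply/le_anti.
  by rewrite finvL_le_finvR // finvR_le_finvL.
- move=> eLR; have [E [mR mE adj]] := finvR_left_adjoint fG.
  by exists E; split=> // [T U TU | S T]; rewrite !eLR; [apply: mR | apply: adj].
- case=> E [_ _ adj]; apply/injmP; apply: contraT => ninj.
  have /(finvL_lt_finvR fG (tr_incl G')) : ~ {in G &, injective f}.
    by move=> /injmP; apply/negP.
  (* A bound by the top of [Tr G'] is free; the adjunction turns it into a lower bound on [finvL] of
     that top, closing the cycle [finvL] < [finvR] <= top of [Tr G] <= [finvL]. *)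
  have /adj topL : (E (tr_incl G) <= tr_incl G')%O by apply: le_tr_incl.
  by move=> /lt_le_trans/(_ (le_trans (le_tr_incl _ _ _) topL)); rewrite ltxx.
Qed.
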